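(* For every integer $n\ge 2$ there is a set $P\subset \mathbb{R}^2$ with $|P|=n$ satisfying: (i) every $4$-point subset of $P$ determines at least $3$ distinct pairwise (Euclidean) distances; and (ii) $\bigl|\{\|p-q\|:\ p,q\in P,\ p\neq q\}\bigr| \le C\,\frac{n}{\sqrt{\log n}}$, where $C>0$ is an absolute constant independent of $n$.
   Context: $\|\cdot\|$ denotes the Euclidean norm on $\mathbb{R}^2$. The big-O bound $O(n/\sqrt{\log n})$ of the paper is written out explicitly with a constant $C$ uniform over all $n\ge 2$. *)

(* Defs.v *)
From mathcomp Require Import all_boot all_order all_algebra finmap.
From mathcomp Require Import all_reals exp.

Set Implicit Arguments.
Unset Strict Implicit.
Unset Printing Implicit Defensive.

Import Order.TTheory GRing.Theory Num.Theory.

Local Open Scope fset_scope.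
Local Open Scope ring_scope.

(* The norm `|v| that MathComp-Analysis puts on 'rV[R]_2 is the sup norm,
   hence the separate definition. *)
Definition euclidean_norm (R : realType) (v : 'rV[R]_2) : R :=
  Num.sqrt (\sum_(i < 2) v 0 i ^+ 2).

Definition distances (R : realType) (P : {fset 'rV[R]_2}) : {fset R} :=
  [fset euclidean_norm (p - q) | p in P, q in P & p != q].

(* Main.v *)
(* The set [P] is a piece of a square array in the lattice
   [{(x, y * sqrt 2) : x, y integers}].

   Four points with at most two distances contain an equilateral triangle or
   form a square or four vertices of a regular pentagon. Squared distances in
   the lattice are integers [x ^ 2 + 2 * y ^ 2]; by Gram determinants the three
   configurations would make 6, 2 or 5 the square of a rational.

   The number of values [x ^ 2 + 2 * y ^ 2 <= N] is [O(N / sqrt (ln N))]. Each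
   value is [t * c ^ 2 * u] with [t] in [{1, 2}] and all divisors of [u]
   congruent to 1 or 3 modulo 8. Let [S] be the sum of [1 / u] over such
   [u <= N]. With [chi] the quadratic character of conductor 8 with
   [chi 1 = chi 3 = 1] and [r = 1 * chi] (Dirichlet convolution), [r] is
   nonnegative and is the number of divisors at every such [u], so
   [S ^ 2 <= \sum_(n <= N ^ 2) r n / n = O(ln N)], the last bound by Abel
   summation. Writing [ln u] as a sum of the von Mangoldt function over the
   divisors of [u], Chebyshev's upper bound gives
   [\sum_(u <= N) ln u = O(N * S)], which turns into
   [O(N * S / ln N) = O(N / sqrt (ln N))] for the count. *)
Require Import Defs.
From mathcomp Require Import all_boot all_order all_algebra finmap.
From mathcomp Require Import all_reals exp.
From mathcomp Require Import zify ring lra.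

Set Implicit Arguments.
Unset Strict Implicit.
Unset Printing Implicit Defensive.

Import Order.TTheory GRing.Theory Num.Theory.

Local Open Scope fset_scope.
Local Open Scope ring_scope.

(** * Numbers with all divisors congruent to 1 or 3 modulo 8 *)

Definition good (u : nat) : bool :=
  (0 < u)%N && all (fun d => (d %% 8 == 1) || (d %% 8 == 3))%N (divisors u).

Lemma goodP u : reflect
  ((0 < u)%N /\ forall d, (d %| u)%N -> (d %% 8 = 1 \/ d %% 8 = 3)%N) (good u).
Proof.
apply: (iffP andP) => -[u0 H]; split=> //.
  move=> d du; have /(allP H) : d \in divisors u by rewrite -dvdn_divisors.
  by case/orP=> /eqP; [left|right].
by apply/allP=> d; rewrite -dvdn_divisors // => /H [] ->.
Qed.

Lemma good_gt0 u : good u -> (0 < u)%N. Proof. by case/andP. Qed.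

Lemma good_dvd d u : (d %| u)%N -> good u -> good d.
Proof.
move=> du /goodP [u0 H]; apply/goodP; split; first exact: dvdn_gt0 du.
by move=> e ed; apply: H; apply: dvdn_trans du.
Qed.

(** A divisor [d] of [a * b] is [gcdn d a] times a divisor of [b], and the residues 1 and 3 are
    closed under multiplication modulo 8. *)
Lemma goodM a b : good a -> good b -> good (a * b).
Proof.
move=> /goodP [a0 Ha] /goodP [b0 Hb]; apply/goodP; split; first by rewrite muln_gt0 a0.
move=> d dab; have g0 : (0 < gcdn d a)%N by rewrite gcdn_gt0 a0 orbT.
have dE : d = (gcdn d a * (d %/ gcdn d a))%N by rewrite mulnC divnK // dvdn_gcdl.
have : (d %/ gcdn d a %| b)%N.
  have co : coprime (d %/ gcdn d a) (a %/ gcdn d a).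
    rewrite /coprime -(eqn_pmul2l g0) muln_gcdr muln1 ![(gcdn d a * (_ %/ _))%N]mulnC.
    by rewrite !divnK // ?dvdn_gcdl ?dvdn_gcdr.
  rewrite -(Gauss_dvdr _ co) -(dvdn_pmul2l g0) mulnA mulnC divnK ?dvdn_gcdl //.
  by rewrite [(gcdn d a * _)%N]mulnC divnK // dvdn_gcdr.
move/Hb => Hq; have /Ha Hg := dvdn_gcdr d a; rewrite dE -modnMm.
by case: Hg => ->; case: Hq => ->; auto.
Qed.

(* Infinite descent: an odd [x < n] with [n %| x ^ 2 + 2] gives
   [x ^ 2 + 2 = n * m] with [m] odd and smaller than [n], and
   [x ^ 2 + 2 = 3 %[mod 8]]. *)
Lemma odd_dvd_sq_add2 n x : odd n -> (n %| x ^ 2 + 2)%N ->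
  (n %% 8 = 1 \/ n %% 8 = 3)%N.
Proof.
elim/ltn_ind: n x => n IH x on nx.
have [->|n1] := eqVneq n 1%N; first by left.
have [y [oy yn ny]] : exists y, [/\ odd y, (y < n)%N & (n %| y ^ 2 + 2)%N].
  have n0 : (0 < n)%N by case: n on {IH nx n1}.
  have nr : (n %| (x %% n) ^ 2 + 2)%N.
    by rewrite /dvdn -modnDml modnXm modnDml.
  have rn : (x %% n < n)%N by rewrite ltn_mod.
  have [o|e] := boolP (odd (x %% n)); first by exists (x %% n)%N.
  (* As [n] is odd, negation modulo [n] flips the parity of a nonzero residue and keeps its square;
     residue 0 would make [n] divide 2. *)
  exists (n - x %% n)%N; split; first by rewrite oddB 1?ltnW // on (negbTE e).
    have [r0|r0] := eqVneq (x %% n)%N 0%N; last by rewrite ltn_subrL lt0n r0.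
    move: nr; rewrite r0 add0n => /dvdn_leq; move: on n1 n0; clear.
    by case: n => [|[|[|n]]] //= _ _ _ /(_ isT).
  have E : ((n - x %% n) ^ 2 + 2 + n * (2 * (x %% n)) = n * n + ((x %% n) ^ 2 + 2))%N by nia.
  by rewrite -(dvdn_addl _ (dvdn_mulr (2 * (x %% n)) (dvdnn n))) E dvdn_add ?dvdn_mulr.
have /dvdnP [m mE] := ny.
have yE : (y ^ 2 + 2 = 3 %[mod 8])%N.
  have : (y = y./2.*2 + 1)%N by rewrite -{1}(odd_double_half y) oy addnC.
  move: (y./2) => k ->; rewrite -muln2.
  have -> : ((k * 2 + 1) ^ 2 + 2 = 4 * (k * k.+1) + 3)%N by nia.
  have /dvdnP [j ->] : (2 %| k * k.+1)%N by rewrite dvdn2 oddM /= andbN.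
  have -> : (4 * (j * 2) + 3 = j * 8 + 3)%N by lia.
  by rewrite modnMDl.
have om : odd m.
  by have : odd (y ^ 2 + 2) by [rewrite oddD oddX oy]; rewrite mE oddM => /andP[].
have mn : (m < n)%N.
  (* Both [y] and [n] are odd, so [y < n] leaves a gap of 2, and then [y ^ 2 + 2 < n ^ 2]. *)
  have yn2 : (y.+2 <= n)%N.
    rewrite ltn_neqAle yn andbT; apply: contraTneq on => <- /=; by rewrite oy.
  rewrite ltnNge; apply/negP => nm; have nn := leq_mul nm (leqnn n).
  by have := leq_mul yn2 yn2; clear -mE nn; nia.
have mx : (m %| y ^ 2 + 2)%N by rewrite mE dvdn_mulr.
have := IH m mn y om mx; move: yE; rewrite mE.
have : (n %% 8 < 8)%N by rewrite ltn_mod.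
have : odd (n %% 8) by rewrite {1}(divn_eq n 8) oddD oddM andbF in on.
rewrite -modnMm => + + + [] mm; rewrite mm;
by case: (n %% 8)%N => [|[|[|[|[|[|[|[|?]]]]]]]] // *; auto.
Qed.

(** * The Kronecker symbol of -2, of conductor 8, and its divisor sum *)

Definition chi (n : nat) : int :=
  nth 0 [:: 0; 1; 0; 1; 0; -1; 0; -1] (n %% 8).

Lemma chiM a b : chi (a * b) = chi a * chi b.
Proof.
rewrite /chi -modnMm.
have : (a %% 8 < 8)%N by rewrite ltn_mod.
have : (b %% 8 < 8)%N by rewrite ltn_mod.
by case: (a %% 8)%N => [|[|[|[|[|[|[|[|?]]]]]]]];
  case: (b %% 8)%N => [|[|[|[|[|[|[|[|?]]]]]]]].
Qed.

Lemma chi_good u : good u -> chi u = 1.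
Proof. by case/goodP=> u0 /(_ u (dvdnn u)) []; rewrite /chi => ->. Qed.

Lemma chi_cases n : [\/ chi n = 0, chi n = 1 | chi n = -1].
Proof.
rewrite /chi; have : (n %% 8 < 8)%N by rewrite ltn_mod.
by case: (n %% 8)%N => [|[|[|[|[|[|[|[|?]]]]]]]] // _;
 by [constructor 1|constructor 2|constructor 3].
Qed.

Lemma sum_chi N :
  \sum_(1 <= d < N.+1) chi d = nth 0 [:: 0; 1; 1; 2; 2; 1; 1; 0] (N %% 8).
Proof.
elim: N => [|N IH]; first by rewrite big_geq.
rewrite big_nat_recr //= IH /chi.
have -> : (N.+1 %% 8 = (N %% 8).+1 %% 8)%N by rewrite -addn1 -modnDml addn1.
have : (N %% 8 < 8)%N by rewrite ltn_mod.
by case: (N %% 8)%N => [|[|[|[|[|[|[|[|?]]]]]]]].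
Qed.

Lemma sum_chi_bounds N : 0 <= \sum_(1 <= d < N.+1) chi d <= 2.
Proof.
rewrite sum_chi; have : (N %% 8 < 8)%N by rewrite ltn_mod.
by case: (N %% 8)%N => [|[|[|[|[|[|[|[|?]]]]]]]].
Qed.

Lemma sum_multiples (V : nmodType) (F : nat -> V) d N : (0 < d)%N ->
  \sum_(1 <= n < N.+1 | (d %| n)%N) F n = \sum_(1 <= k < (N %/ d).+1) F (d * k)%N.
Proof.
move=> d0; elim: N => [|N IH]; first by rewrite div0n !big_geq.
rewrite big_mkcond big_nat_recr //= -big_mkcond IH divnS //=.
have [dN|dN] := boolP (d %| N.+1)%N; last by rewrite addr0 add0n.
rewrite add1n [RHS]big_nat_recr //=; congr (_ + F _).
by rewrite -[LHS](divnK dN) divnS // dN mulnC.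
Qed.

(** Both sides run over the positive pairs with [d * k <= N]. *)
Lemma sum_hyperbola (V : nmodType) (F : nat -> nat -> V) N :
  \sum_(1 <= d < N.+1) \sum_(1 <= k < (N %/ d).+1) F d k =
  \sum_(1 <= k < N.+1) \sum_(1 <= d < (N %/ k).+1) F d k.
Proof.
have E (G : nat -> nat -> V) : \sum_(1 <= d < N.+1) \sum_(1 <= k < (N %/ d).+1) G d k =
    \sum_(1 <= d < N.+1) \sum_(1 <= k < N.+1 | (d * k <= N)%N) G d k.
  apply: eq_big_nat => d /andP[d0 dN].
  rewrite (big_nat_widen _ _ N.+1) ?ltnS ?leq_div //.
  by apply: eq_bigl => k; rewrite ltnS leq_divRL // mulnC.
rewrite (E F) (E (fun k d => F d k)) (exchange_big_dep_nat xpredT) //=.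
by apply: eq_bigr => k _; apply: eq_bigl => d; rewrite mulnC.
Qed.

Definition rsum (n : nat) : int := \sum_(1 <= d < n.+1 | (d %| n)%N) chi d.

Lemma sum_dvdn_widen (V : nmodType) (F : nat -> V) n N : (0 < n <= N)%N ->
  \sum_(1 <= d < N.+1 | (d %| n)%N) F d = \sum_(1 <= d < n.+1 | (d %| n)%N) F d.
Proof.
move=> /andP[n0 nN]; rewrite [RHS](big_nat_widen _ _ N.+1) //.
apply: eq_bigl => d; have [dn|//] := boolP (d %| n)%N.
by rewrite ltnS dvdn_leq.
Qed.

(** The divisors prime to [p] are those of [m]; the others are [p] times the divisors of
    [p ^ k * m]. *)
Lemma rsumM p m k : prime p -> (0 < m)%N -> ~~ (p %| m)%N ->
  rsum (p ^ k.+1 * m) = rsum m + chi p * rsum (p ^ k * m).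
Proof.
move=> pp m0 pm; have p0 := prime_gt0 pp.
rewrite /rsum (bigID (fun d => p %| d)%N) /= addrC; congr (_ + _).
  rewrite -[RHS](@sum_dvdn_widen _ _ _ (p ^ k.+1 * m)); last first.
    by rewrite m0 leq_pmull // expn_gt0 p0.
  apply: eq_bigl => d; apply/andP/idP => [[dpm pd]|dm].
    by rewrite Gauss_dvdr // in dpm; rewrite coprime_sym coprimeXl // prime_coprime.
  split; first exact: dvdn_mull.
  by apply: contra pm => /dvdn_trans; apply.
under eq_bigl => d do rewrite andbC.
rewrite big_mkcondr sum_multiples // expnS -mulnA mulKn // -big_mkcond /= mulr_sumr.
by apply: eq_big => [d|d _]; rewrite ?dvdn_pmul2l ?chiM.
Qed.

(** Along the powers of a prime [p], [rsumM] is a recursion: constant if [chi p = 0], nondecreasing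
    if [chi p = 1]. If [chi p = -1] it alternates between [rsum m] and 0, whence the two-sided bound
    in that case. *)
Lemma rsum_ge0 n : 0 <= rsum n.
Proof.
elim/ltn_ind: n => n IH.
have [n1|n1] := leqP n 1.
  by case: n n1 {IH} => [|[|//]] _; rewrite /rsum big_mkcond ?big_nat1 ?big_geq.
have pp := pdiv_prime n1; have n0 : (0 < n)%N by exact: ltnW.
have [m co nE] := pfactor_coprime pp n0.
have m0 : (0 < m)%N by move: n0; rewrite {1}nE; case: (m).
have pm : ~~ (pdiv n %| m)%N by rewrite -prime_coprime.
have mn : (m < n)%N.
  rewrite ltn_neqAle; apply/andP; split; last by rewrite dvdn_leq // nE dvdn_mulr.
  by apply: contra pm => /eqP ->; exact: pdiv_dvd.
have rm := IH m mn; rewrite nE mulnC.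
set k := logn _ n; have [c|c|c] := chi_cases (pdiv n).
- by case: k => [|k]; rewrite ?mul1n // rsumM // c mul0r addr0.
- elim: k => [|k IHk]; first by rewrite mul1n.
  by rewrite rsumM // c mul1r addr_ge0.
- suff /andP[] : 0 <= rsum (pdiv n ^ k * m) <= rsum m by [].
  elim: k => [|k /andP[k0 km]]; first by rewrite mul1n rm /=.
  by rewrite rsumM // c mulN1r subr_ge0 km lerBlDr lerDl.
Qed.

(** * Sums of reciprocals over all integers and over good numbers *)

Section RealSums.
Context {R : realType}.
Implicit Types (N M : nat) (h : nat -> R).

Definition harm N : R := \sum_(1 <= k < N.+1) k%:R^-1.

Definition good_sum N : R := \sum_(1 <= u < N.+1 | good u) u%:R^-1.

Lemma harm_le m n : (m <= n)%N -> harm m <= harm n.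
Proof.
move=> mn; rewrite /harm (big_cat_nat (n := m.+1) (p := n.+1)) //= lerDl.
by apply: sumr_ge0 => k _; rewrite invr_ge0.
Qed.

Lemma harm_le_ln n : (0 < n)%N -> harm n <= 1 + ln n%:R.
Proof.
case: n => // n _; elim: n => [|n IH].
  by rewrite /harm big_nat1 invr1 ln1 addr0.
rewrite /harm big_nat_recr //=; apply: le_trans (lerD IH (lexx _)) _.
rewrite -addrA lerD2l -lerBrDl.
have n1 : (0 : R) < n.+1%:R by []. have n2 : (0 : R) < n.+2%:R by [].
have -> : ln (n.+1%:R : R) = ln n.+2%:R + ln (1 - n.+2%:R^-1).
  rewrite -lnM ?posrE //; last by rewrite subr_gt0 invf_lt1 // ltr1n.
  congr ln; rewrite mulrBr mulr1 mulfV ?lt0r_neq0 //.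
  by rewrite -[n.+2%:R]natr1 addrK.
rewrite opprD addNKr lerNr; apply: le_trans (le_ln1Dx _) _ => //.
by rewrite ltrN2 invf_lt1 // ltr1n.
Qed.

Lemma sum_chi_le h N : (0 < N)%N ->
  (forall d, (0 < d < N)%N -> h d.+1 <= h d) -> 0 <= h N ->
  \sum_(1 <= d < N.+1) (chi d)%:~R * h d <= 2 * h 1%N.
Proof.
move=> N0 hm hN.
(* Abel summation as an induction: the factor of [h n] is nonnegative because the character sums are
   at most 2, so passing to the smaller [h n.+1] preserves the bound. *)
suff H n : (0 < n <= N)%N -> \sum_(1 <= d < n.+1) (chi d)%:~R * h d <=
    2 * h 1%N - (2 - (\sum_(1 <= d < n.+1) chi d)%:~R) * h n.
  apply: le_trans (H N _) _; first by rewrite N0 leqnn.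
  rewrite gerBl mulr_ge0 // subr_ge0 -[2]/(2%:~R) ler_int.
  by case/andP: (sum_chi_bounds N).
elim: n => // -[_ _|n IH /andP[_ nN]].
  by rewrite !big_nat1 (@chi_good 1) //; lra.
rewrite big_nat_recr //= [X in (2 - X%:~R)]big_nat_recr //=.
apply: le_trans (lerD (IH (ltnW nN)) (lexx _)) _.
have X2 : (\sum_(1 <= d < n.+2) chi d)%:~R <= 2 :> R.
  by rewrite -[2]/(2%:~R) ler_int; case/andP: (sum_chi_bounds n.+1).
have := hm n.+1 nN; rewrite rmorphD /=.
set X := _%:~R in X2 *; set c := _%:~R; nra.
Qed.

(** Exchanging the sums gives [chi d] the weight [harm (M %/ d) / d], which is nonincreasing in
    [d]. *)
Lemma sum_rsum_le M :
  \sum_(1 <= n < M.+1) (rsum n)%:~R / n%:R <= 2 * harm M.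
Proof.
have [->|M0] := posnP M.
  by rewrite /harm !big_geq ?mulr0.
have -> : \sum_(1 <= n < M.+1) (rsum n)%:~R / n%:R =
    \sum_(1 <= d < M.+1) (chi d)%:~R * (harm (M %/ d) / d%:R) :> R.
  transitivity (\sum_(1 <= n < M.+1) \sum_(1 <= d < M.+1 | (d %| n)%N)
      (chi d)%:~R / n%:R : R).
    apply: eq_big_nat => n /andP[n0 nM].
    rewrite sum_dvdn_widen ?n0 // -mulr_suml; congr (_ / _).
    by rewrite /rsum rmorph_sum.
  rewrite (exchange_big_dep_nat xpredT) //=; apply: eq_big_nat => d /andP[d0 dM].
  rewrite sum_multiples // -mulr_sumr; congr (_ * _).
  rewrite /harm mulr_suml; apply: eq_bigr => k _.
  by rewrite natrM invfM mulrC.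
apply: le_trans (sum_chi_le M0 _ _) _.
- move=> d /andP[d0 dM]; rewrite ler_pM ?invr_ge0 //.
  + by apply: sumr_ge0 => k _; rewrite invr_ge0.
  + by rewrite harm_le // leq_div2l.
  + by rewrite lef_pV2 ?posrE ?ltr0n // ler_nat.
- by apply: mulr_ge0; rewrite ?invr_ge0 //; apply: sumr_ge0 => k _; rewrite invr_ge0.
by rewrite divn1 divr1.
Qed.

(* On good [n] every divisor has [chi d = 1], so [rsum n] is the number of
   divisors. *)
Lemma good_pairs_le_rsum n : (0 < n)%N ->
  \sum_(1 <= a < n.+1 | (a %| n)%N) (good a && good (n %/ a))%:R <= rsum n.
Proof.
move=> n0; have [gn|ngn] := boolP (good n).
  rewrite /rsum !(big_mkcond (fun a => a %| n)%N) ler_sum_nat // => a _.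
  case: ifP => // an; rewrite (chi_good (good_dvd an gn)).
  by case: (_ && _).
rewrite big1 ?rsum_ge0 // => a an; case: (boolP (good a)) => //= ga.
have [gna|//] := boolP (good (n %/ a)).
by case/negP: ngn; rewrite -(divnK an) goodM.
Qed.

Lemma good_sum_le M N : (M <= N)%N -> good_sum M <= good_sum N.
Proof.
move=> MN; rewrite /good_sum (big_cat_nat (n := M.+1) (p := N.+1)) //= lerDl.
by apply: sumr_ge0 => k _; rewrite invr_ge0.
Qed.

Lemma good_sum_ge0 N : 0 <= good_sum N.
Proof. by apply: sumr_ge0 => k _; rewrite invr_ge0. Qed.

(** Expand the square over good pairs [a, b <= N], enlarge the range to [a * b <= N ^ 2] (the sum
    [T]), and group by the product [n]; at most [rsum n] pairs share it. *)
Lemma good_sum_sqr N : good_sum N ^+ 2 <= 2 * harm (N ^ 2).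
Proof.
apply: le_trans (sum_rsum_le _); set M := (N ^ 2)%N.
have NM : (N <= M)%N by rewrite /M; case: (N) => // k; rewrite leq_pmulr.
pose T := \sum_(1 <= a < M.+1 | good a) a%:R^-1 * good_sum (M %/ a).
apply: (@le_trans _ _ T).
  rewrite /T (big_cat_nat (n := N.+1) (p := M.+1)) //=.
  apply: (@le_trans _ _ (\sum_(1 <= a < N.+1 | good a) a%:R^-1 * good_sum (M %/ a))).
    rewrite expr2 {1}/good_sum mulr_suml !(big_mkcond good) ler_sum_nat // => a /andP[a0 aN].
    case: ifP => // _; rewrite ler_wpM2l ?invr_ge0 // good_sum_le //.
    by rewrite leq_divRL // /M -mulnn leq_mul2l -ltnS aN orbT.
  by rewrite lerDl; apply: sumr_ge0 => k _; rewrite mulr_ge0 ?invr_ge0 // good_sum_ge0.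
have -> : T = \sum_(1 <= n < M.+1)
   \sum_(1 <= a < M.+1 | (a %| n)%N) (good a && good (n %/ a))%:R / n%:R.
  rewrite (exchange_big_dep_nat xpredT) //= /T big_mkcond; apply: eq_big_nat => a /andP[a0 aM].
  rewrite sum_multiples //; case: (boolP (good a)) => ga /=; last first.
    by rewrite big1 // => k _; rewrite mul0r.
  rewrite /good_sum mulr_sumr big_mkcond; apply: eq_bigr => k _.
  rewrite mulKn //; case: (good k); rewrite ?mul0r // mul1r.
  by rewrite natrM invfM.
rewrite ler_sum_nat // => n /andP[n0 nM].
rewrite sum_dvdn_widen ?n0 // -mulr_suml ler_wpM2r ?invr_ge0 //.
have := good_pairs_le_rsum n0; rewrite -(ler_int R); apply: le_trans.
by rewrite rmorph_sum /=; apply: ler_sum => a _; case: (_ && _).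
Qed.

Lemma ln_ge_half N : (1 < N)%N -> 2^-1 <= ln N%:R :> R.
Proof.
move=> N1; apply: (@le_trans _ _ (ln 2)); last first.
  by rewrite ler_ln ?posrE ?ltr0n ?ler_nat // ltnW.
have -> : ln 2 = - ln 2^-1 :> R by rewrite lnV ?posrE // opprK.
rewrite lerNr.
by have := @le_ln1Dx R (- 2^-1); rewrite (_ : 1 + - 2^-1 = 2^-1); [apply; lra | lra].
Qed.

Lemma good_sum_sqr_le N : (1 < N)%N -> good_sum N ^+ 2 <= 8 * ln N%:R.
Proof.
move=> N1; have N0 : (0 < N)%N by exact: ltnW.
apply: le_trans (good_sum_sqr N) _.
apply: le_trans (ler_wpM2l _ (@harm_le_ln (N ^ 2) _)) _ => //.
  by rewrite expn_gt0 N0.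
(* [2 * (1 + 2 * L) <= 8 * L] as soon as [L >= 1 / 2]. *)
have := ln_ge_half N1; rewrite -mulnn natrM lnM ?posrE ?ltr0n //; lra.
Qed.

(** * Chebyshev's bound *)

(* The equation on [d] says that [d] is a prime power. *)
Definition mangoldt (d : nat) : R :=
  if (1 < d)%N && (d == pdiv d ^ logn (pdiv d) d)%N then ln (pdiv d)%:R else 0.

Lemma mangoldt_ge0 d : 0 <= mangoldt d.
Proof. by rewrite /mangoldt; case: ifP => // _; rewrite ln_ge0 // ler1n pdiv_gt0. Qed.

Lemma mangoldt_pfactor p k : prime p -> (0 < k)%N -> mangoldt (p ^ k) = ln p%:R.
Proof.
case: k => // k pp _; rewrite /mangoldt pdiv_pfactor // pfactorK // eqxx andbT.
by rewrite -{1}(exp1n k.+1) ltn_exp2r // prime_gt1.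
Qed.

(** Induction on [n = p * m]: the only prime power dividing [n] but not [m] is the full power
    [p ^ k], and it contributes [ln p]. *)
Lemma sum_mangoldt n : (0 < n)%N ->
  \sum_(1 <= d < n.+1 | (d %| n)%N) mangoldt d = ln n%:R.
Proof.
elim/ltn_ind: n => n IH n0; have [n1|n1] := leqP n 1.
  have -> : n = 1%N by lia.
  by rewrite big_mkcond big_nat1 /= ln1.
set p := pdiv n; have pp : prime p := pdiv_prime n1.
have p0 := prime_gt0 pp.
have nE : n = (p * (n %/ p))%N by rewrite mulnC divnK // pdiv_dvd.
set m := (n %/ p)%N in nE.
have m0 : (0 < m)%N by move: n0; rewrite nE; case: (m); rewrite ?muln0.
have mn : (m < n)%N by rewrite nE ltn_Pmull // prime_gt1.
set k := logn p n; have k0 : (0 < k)%N by rewrite logn_gt0 mem_primes pp n0 pdiv_dvd.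
have kE : k = (logn p m).+1 by rewrite /k nE lognM // logn_prime // eqxx.
have pkn : (p ^ k %| n)%N by rewrite pfactor_dvdn.
rewrite (bigID (fun d => d %| m)%N) /=.
have -> : \sum_(1 <= d < n.+1 | (d %| n)%N && (d %| m)%N) mangoldt d = ln m%:R.
  rewrite -(IH m mn m0) -(@sum_dvdn_widen _ _ m n); last by rewrite m0 ltnW.
  apply: eq_bigl => d; apply/andP/idP => [[]|dm] //; split => //.
  by rewrite nE dvdn_mull.
rewrite [X in _ = ln X%:R]nE natrM lnM ?posrE ?ltr0n // addrC; congr (_ + _).
rewrite -(@mangoldt_pfactor p k) //.
have pkm : ~~ (p ^ k %| m)%N by rewrite pfactor_dvdn // kE ltnn.
rewrite big_mkcond (bigD1_seq (p ^ k)%N) ?iota_uniq //=; last first.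
  by rewrite mem_index_iota expn_gt0 p0 ltnS dvdn_leq.
rewrite pkn pkm /= big1 ?addr0 // => d dk; case: ifP => // /andP[dn dm].
rewrite /mangoldt; case: ifP => // /andP[d1 /eqP dE]; exfalso; move/negP: dm; apply.
have qp := pdiv_prime d1.
move: dE dn dk d1 qp; set q := pdiv d; set j := logn q d => -> dn dk _ qp.
have [qE|qp'] := eqVneq q p.
  rewrite qE in dn dk *; move: dn.
  rewrite !pfactor_dvdn // -/k kE leq_eqVlt => /orP[/eqP jk|//].
  by rewrite jk -kE eqxx in dk.
by move: dn; rewrite nE Gauss_dvdr // coprimeXl // prime_coprime // dvdn_prime2.
Qed.

Definition psi n : R := \sum_(1 <= d < n.+1) mangoldt d.

Lemma ln_fact n : ln n`!%:R = \sum_(1 <= d < n.+1) mangoldt d * (n %/ d)%:R :> R.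
Proof.
transitivity (\sum_(1 <= m < n.+1) \sum_(1 <= d < n.+1 | (d %| m)%N) mangoldt d).
  elim: n => [|n IH]; first by rewrite fact0 ln1 big_geq.
  rewrite factS natrM lnM ?posrE ?ltr0n ?fact_gt0 // big_nat_recr //=.
  rewrite -sum_mangoldt // addrC; congr (_ + _); rewrite IH.
  apply: eq_big_nat => m /andP[m0 mn].
  by rewrite !sum_dvdn_widen // m0 -ltnS // ltnW.
rewrite (exchange_big_dep_nat xpredT) //=; apply: eq_big_nat => d /andP[d0 dn].
by rewrite sum_multiples // big_const_nat subn1 iter_addr_0 mulr_natr.
Qed.

(** Expand [ln 'C(n, m)], which is at most [n * ln 2], by [ln_fact]. All coefficients are
    nonnegative, and for [m < d <= n] they are at least 1, because [n - m <= m < d]. *)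
Lemma psi_step m n : (m <= n <= m.*2)%N -> psi n <= psi m + n%:R.
Proof.
move=> /andP[mn nm].
apply: (@le_trans _ _ (psi m + ln 'C(n, m)%:R)); last first.
  rewrite lerD2l; apply: (@le_trans _ _ (ln (2 ^ n)%:R)).
    rewrite ler_ln ?posrE ?ltr0n ?bin_gt0 ?expn_gt0 // ler_nat.
    rewrite -[2%N]/(1 + 1)%N expnDn (bigD1 (Ordinal (mn : (m < n.+1)%N))) //=.
    by rewrite !exp1n !muln1 leq_addr.
  rewrite natrX lnXn // -[leRHS]mul1r -[leLHS]mulr_natr ler_wpM2r //.
  by have := @le_ln1Dx R 1; rewrite -[1 + 1]/2; apply; lra.
have -> : ln 'C(n, m)%:R = ln n`!%:R - ln m`!%:R - ln (n - m)`!%:R :> R.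
  rewrite -(bin_fact mn) !natrM !lnM ?posrE ?mulr_gt0 ?ltr0n ?fact_gt0 ?bin_gt0 //; lra.
have ext k : (k <= n)%N -> ln k`!%:R = \sum_(1 <= d < n.+1) mangoldt d * (k %/ d)%:R :> R.
  move=> kn; rewrite ln_fact [RHS](big_cat_nat (n := k.+1)) //=.
  rewrite [X in _ + X]big_nat_cond [X in _ + X]big1 ?addr0 // => d.
  by rewrite andbT => /andP[kd _]; rewrite divn_small // mulr0.
have -> : psi m = \sum_(1 <= d < n.+1) mangoldt d * (d <= m)%N%:R.
  rewrite /psi [RHS](big_cat_nat (n := m.+1)) //=.
  rewrite [X in _ = _ + X]big_nat_cond [X in _ = _ + X]big1 ?addr0; last first.
    by move=> d; rewrite andbT => /andP[kd _]; rewrite leqNgt kd mulr0.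
  by apply: eq_big_nat => d /andP[_ dm]; rewrite -ltnS dm mulr1.
rewrite !ext // ?leq_subr // -!sumrB -big_split /= /psi ler_sum_nat // => d /andP[d0 dn].
rewrite -!mulrBr -mulrDr ler_peMr ?mangoldt_ge0 //.
have [dm|dm] := leqP d m.
  rewrite lerDl -addrA -opprD subr_ge0 -natrD ler_nat.
  by rewrite -[X in (_ <= X %/ _)%N](subnKC mn) divnD // leq_addr.
rewrite add0r (divn_small dm) subr0 (@divn_small (n - m)) ?subr0; last by lia.
by rewrite ler1n divn_gt0.
Qed.

Lemma psi_le n : psi n <= 4 * n%:R.
Proof.
have [->|n0] := posnP n; first by rewrite /psi big_geq ?mulr0.
(* The extra [- 4] absorbs the rounding in [uphalf n] when the induction halves [n]. *)
suff : psi n <= 4 * (n%:R - 1) by lra.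
elim/ltn_ind: n n0 => n IH n0; have [n1|n1] := leqP n 1.
  have -> : n = 1%N by lia.
  by rewrite /psi big_nat1 /mangoldt /= subrr mulr0.
apply: le_trans (@psi_step (uphalf n) n _) _; first by lia.
have : psi (uphalf n) <= 4 * ((uphalf n)%:R - 1) by apply: IH; lia.
have : 2 * (uphalf n)%:R <= n%:R + 1 :> R by rewrite -natrM natr1 ler_nat; lia.
have : 2 <= n%:R :> R by rewrite ler_nat.
lra.
Qed.

Lemma ler_divn N k : (N %/ k)%:R <= N%:R / k%:R :> R.
Proof.
have [->|k0] := posnP k; first by rewrite divn0 invr0 mulr0.
by rewrite ler_pdivlMr ?ltr0n // -natrM ler_nat leq_trunc_div.
Qed.

(** * Counting products of a square and a good number *)

(** In [u = d * k] the cofactor [k] is again good; dropping the condition on [d] leaves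
    [psi (N %/ k)] for each good [k]. *)
Lemma sum_ln_good N :
  \sum_(1 <= u < N.+1 | good u) ln u%:R <= 4 * N%:R * good_sum N :> R.
Proof.
have -> : \sum_(1 <= u < N.+1 | good u) ln u%:R = \sum_(1 <= u < N.+1 | good u)
    \sum_(1 <= d < N.+1 | (d %| u)%N) mangoldt d.
  rewrite big_nat_cond [RHS]big_nat_cond; apply: eq_bigr => u /andP[/andP[u0 uN] _].
  by rewrite sum_dvdn_widen ?u0 // sum_mangoldt.
rewrite (exchange_big_dep_nat xpredT) //=.
pose F d k := if good k then mangoldt d else 0.
apply: (@le_trans _ _ (\sum_(1 <= d < N.+1) \sum_(1 <= k < (N %/ d).+1) F d k)).
  rewrite ler_sum_nat // => d /andP[d0 dN].
  under eq_bigl => u do rewrite andbC.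
  rewrite big_mkcondr sum_multiples // ler_sum // => k _; rewrite /F.
  case: ifP => [/(good_dvd (dvdn_mull d (dvdnn k))) -> //|_].
  by case: ifP => // _; exact: mangoldt_ge0.
rewrite sum_hyperbola /good_sum mulr_sumr [leRHS]big_mkcond /=.
rewrite ler_sum_nat // => k /andP[k0 kN]; rewrite /F; case: ifP => _; last by rewrite big1.
apply: le_trans (psi_le _) _; rewrite -mulrA ler_wpM2l //; exact: ler_divn.
Qed.

Lemma sum_inv_sqr N : \sum_(1 <= c < N.+1) (c ^ 2)%:R^-1 <= 2 :> R.
Proof.
case: N => [|N]; first by rewrite big_geq.
suff : \sum_(1 <= c < N.+2) (c ^ 2)%:R^-1 <= 2 - N.+1%:R^-1 :> R.
  by move/le_trans; apply; rewrite gerBl invr_ge0.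
elim: N => [|N IH]; first by rewrite big_nat1 invr1; lra.
rewrite big_nat_recr //=; apply: le_trans (lerD IH (lexx _)) _.
have n0 : (0 : R) < N.+1%:R by [].
rewrite natrX -(natr1 N.+1); move: (N.+1%:R) n0 => x x0.
rewrite -subr_ge0.
have -> : 2 - (x + 1)^-1 - (2 - x^-1 + ((x + 1) ^+ 2)^-1) = (x * (x + 1) ^+ 2)^-1.
  by field; lra.
by rewrite invr_ge0; nra.
Qed.

Lemma sum_ln_sqr N : \sum_(1 <= c < N.+1) ln c%:R / (c ^ 2)%:R <= 2 :> R.
Proof.
case: N => [|N]; first by rewrite big_geq.
(* The subtracted tail is modelled on [(ln x + 1) / x], the integral of [ln t / t ^ 2] from [x] to
   infinity; 2 in place of 1 leaves room for the discrete step. *)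
suff : \sum_(1 <= c < N.+2) ln c%:R / (c ^ 2)%:R <= 2 - (ln N.+1%:R + 2) / N.+1%:R :> R.
  by move/le_trans; apply; rewrite gerBl divr_ge0 // addr_ge0 // ln_ge0 // ler1n.
elim: N => [|N IH]; first by rewrite big_nat1 ln1; lra.
rewrite big_nat_recr //=; apply: le_trans (lerD IH (lexx _)) _.
have n0 : (0 : R) < N.+1%:R by [].
have L0 : (0 : R) <= ln N.+2%:R by rewrite ln_ge0 // ler1n.
have Ll : ln N.+2%:R <= ln N.+1%:R + N.+1%:R^-1 :> R.
  rewrite -lerBlDl -ln_div ?posrE //.
  have -> : N.+2%:R / N.+1%:R = 1 + N.+1%:R^-1 :> R.
    by rewrite -natr1 mulrDl mulfV ?lt0r_neq0 // mul1r.
  by apply: le_ln1Dx; rewrite (@lt_le_trans _ _ 0) // ?ltrN10 ?invr_ge0.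
rewrite natrX; move: Ll L0; rewrite -(natr1 N.+1).
have x1 : 1 <= N.+1%:R :> R by rewrite ler1n.
move: (N.+1%:R : R) n0 x1 (ln N.+1%:R) (ln (N.+1%:R + 1)) => x x0 x1 l L Ll L0.
have l' : (L - x^-1 + 2) / x <= (l + 2) / x by rewrite ler_wpM2r ?invr_ge0 ?(ltW x0) //; lra.
suff : L / (x + 1) ^+ 2 <= (L - x^-1 + 2) / x - (L + 2) / (x + 1) by lra.
rewrite -subr_ge0.
have -> : (L - x^-1 + 2) / x - (L + 2) / (x + 1) - L / (x + 1) ^+ 2 =
   (L * x + (x ^+ 2 - 1)) / (x ^+ 2 * (x + 1) ^+ 2).
  by field; lra.
have x2 : 0 <= x ^+ 2 - 1 by rewrite subr_ge0 exprn_ege1.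
have xr := ltW x0; apply: divr_ge0; first by rewrite addr_ge0 ?mulr_ge0.
by rewrite mulr_ge0 // exprn_ge0 // addr_ge0.
Qed.

(** Pairs [(c, u)] are counted, not values [c ^ 2 * u]; repetitions only enlarge this upper
    bound. *)
Definition count_sqr_good N : R :=
  \sum_(1 <= c < N.+1) \sum_(1 <= u < (N %/ c ^ 2).+1 | good u) 1.

(** Split [ln N = ln u + 2 * ln c + ln y] with [y = N / (c ^ 2 * u)] and use [ln y <= y]. For each
    [c] the three parts are controlled by [sum_ln_good], the number of [u], and [good_sum]. *)
Lemma count_sqr_good_ln N :
  (0 < N)%N -> count_sqr_good N * ln N%:R <= 14 * N%:R * good_sum N.
Proof.
move=> N0; have Nr : 0 < N%:R :> R by rewrite ltr0n.
set S := good_sum N.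
have S1 : 1 <= S.
  rewrite /S /good_sum big_ltn_cond //= invr1 lerDl.
  by apply: sumr_ge0 => k _; rewrite invr_ge0.
(* Here 5 is 4 from [sum_ln_good] plus 1 from [ln y <= y]. Both series in [c] are at most 2, and
   [1 <= S], so the total is [5 * 2 + 2 * 2 = 14]. *)
apply: (@le_trans _ _ (\sum_(1 <= c < N.+1)
   (5 * N%:R * S * (c ^ 2)%:R^-1 + 2 * N%:R * (ln c%:R / (c ^ 2)%:R)))); last first.
  rewrite big_split /= -!mulr_sumr.
  have NS : 0 <= N%:R * S by rewrite mulr_ge0 ?ltW // (lt_le_trans _ S1).
  have := ler_wpM2l NS (sum_inv_sqr N); have := ler_wpM2l (ltW Nr) (sum_ln_sqr N).
  have := ler_wpM2l (ltW Nr) S1; lra.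
rewrite mulr_suml ler_sum_nat // => c /andP[c0 cN].
have c2 : (0 < c ^ 2)%N by rewrite expn_gt0 c0.
have c2r : 0 < (c ^ 2)%:R :> R by rewrite ltr0n.
have lc : 0 <= ln c%:R :> R by rewrite ln_ge0 // ler1n.
set M := (N %/ c ^ 2)%N.
have MN : M%:R <= N%:R / (c ^ 2)%:R :> R := ler_divn _ _.
have SM : good_sum M <= S by apply: good_sum_le; rewrite leq_div.
rewrite mulr_suml.
apply: (@le_trans _ _ (\sum_(1 <= u < M.+1 | good u)
    (ln u%:R + 2 * ln c%:R + N%:R / (c ^ 2)%:R * u%:R^-1))).
  apply: ler_sum => u gu; rewrite mul1r.
  have u0 : 0 < u%:R :> R by rewrite ltr0n good_gt0.
  set y := N%:R / _ * _.
  have y0 : 0 < y by rewrite mulr_gt0 ?divr_gt0 ?invr_gt0.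
  have -> : N%:R = u%:R * (c ^ 2)%:R * y :> R 
    by rewrite /y mulrC mulrA !divfK ?lt0r_neq0.
  move: y y0 => y y0; rewrite !lnM ?posrE ?mulr_gt0 //.
  rewrite natrX lnXn ?ltr0n // [2 * _]mulr_natl lerD2l.
  by apply: ltW; exact: ln_sublinear.
rewrite !big_split /= -[X in _ + X]mulr_sumr -/(good_sum M).
have h1 : \sum_(1 <= u < M.+1 | good u) ln u%:R <= 4 * (N%:R / (c ^ 2)%:R) * S.
  apply: le_trans (sum_ln_good M) _.
  by rewrite ler_pM ?mulr_ge0 ?good_sum_ge0 // ler_wpM2l.
have h2 : \sum_(1 <= u < M.+1 | good u) 2 * ln c%:R <= N%:R / (c ^ 2)%:R * (2 * ln c%:R) :> R.
  apply: (@le_trans _ _ (\sum_(1 <= u < M.+1) 2 * ln c%:R : R)).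
    by rewrite [leLHS]big_mkcond ler_sum // => u _; case: ifP => // _; rewrite mulr_ge0.
  by rewrite big_const_nat subn1 iter_addr_0 -[leLHS]mulr_natl ler_wpM2r // mulr_ge0.
have h3 : N%:R / (c ^ 2)%:R * good_sum M <= N%:R / (c ^ 2)%:R * S.
  by rewrite ler_wpM2l // divr_ge0.
move: h1 h2 h3; set x := (_ ^ _)%:R^-1; lra.
Qed.

Lemma count_sqr_good_le N :
  (1 < N)%N -> count_sqr_good N <= 42 * N%:R / Num.sqrt (ln N%:R).
Proof.
move=> N1; have l0 : 0 < ln N%:R :> R by apply: lt_le_trans (ln_ge_half N1); rewrite invr_gt0.
have s0 : 0 < Num.sqrt (ln N%:R) :> R by rewrite sqrtr_gt0.
have sE : Num.sqrt (ln N%:R) ^+ 2 = ln N%:R :> R by rewrite sqr_sqrtr // ltW.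
have H := count_sqr_good_ln (ltnW N1); have G := good_sum_sqr_le N1.
(* 3 exceeds the square root of 8, and [14 * 3 = 42]. *)
have S3 : good_sum N <= 3 * Num.sqrt (ln N%:R).
  rewrite -(ler_pXn2r (n := 2)) ?nnegrE ?good_sum_ge0 ?mulr_ge0 ?(ltW s0) //.
  by rewrite exprMn sE; apply: le_trans G _; rewrite ler_wpM2r ?(ltW l0) //; lra.
rewrite ler_pdivlMr // -(ler_pM2r s0) -mulrA -expr2 sE.
apply: le_trans H _; have := ler_wpM2l (ler0n R N) S3; lra.
Qed.

End RealSums.

(** * Four points with two distances *)

(* The pair [(x, y)] stands for the point [(x, y * sqrt 2)]. *)
Definition sqdist (p q : int * int) : int :=
  (p.1 - q.1) ^+ 2 + 2 * (p.2 - q.2) ^+ 2.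

Lemma sqdistC p q : sqdist p q = sqdist q p.
Proof. by rewrite /sqdist -sqrrN opprB -[in X in _ + X]sqrrN opprB. Qed.

Lemma sqdist_eq0 p q : (sqdist p q == 0) = (p == q).
Proof.
rewrite /sqdist paddr_eq0 ?sqr_ge0 //; last by rewrite mulr_ge0 ?sqr_ge0.
have e (y : int) : (2 * y ^+ 2 == 0) = (y == 0) by rewrite mulf_eq0 /= sqrf_eq0.
by rewrite e sqrf_eq0 !subr_eq0; case: p q => [a b] [c d].
Qed.

(** For nonzero [y] the [p]-adic valuation would be even on the left and odd on the right. *)
Lemma sqr_eq_mul_prime_odd (p k : nat) (x y : int) : prime p -> odd (logn p k) ->
  x ^+ 2 = k%:R * y ^+ 2 -> y = 0.
Proof.
move=> pp ok; have [//|y0] := eqVneq y 0.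
have k0 : (0 < k)%N by case: k ok => //; rewrite logn0.
move/(congr1 absz); rewrite abszM !abszX natz absz_nat => E; exfalso.
have x0 : (0 < `|x|)%N.
  by rewrite lt0n; apply/eqP => x0; move: E; rewrite x0; have := absz_gt0 y; rewrite y0; nia.
have := congr1 (odd \o logn p) E => /=.
by rewrite lognM ?expn_gt0 ?absz_gt0 ?y0 // !lognX oddD !oddM /= ok.
Qed.

Definition dot (o p q : int * int) : int :=
  (p.1 - o.1) * (q.1 - o.1) + 2 * ((p.2 - o.2) * (q.2 - o.2)).

(** The determinant in lattice coordinates; the Euclidean one is [sqrt 2] times it, whence the
    factor 2 in [cross_sqr]. *)
Definition cross (o p q : int * int) : int :=
  (p.1 - o.1) * (q.2 - o.2) - (p.2 - o.2) * (q.1 - o.1).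

Lemma dot_sqdist o p q :
  2 * dot o p q = sqdist o p + sqdist o q - sqdist p q.
Proof. by rewrite /dot /sqdist; ring. Qed.

Lemma cross_sqr o p q :
  2 * cross o p q ^+ 2 = sqdist o p * sqdist o q - dot o p q ^+ 2.
Proof. by rewrite /dot /cross /sqdist; ring. Qed.

(* The Gram determinant of three vectors of the plane vanishes. *)
Lemma gram0 o p q r :
  sqdist o p * (sqdist o q * sqdist o r - dot o q r ^+ 2)
  - dot o p q * (dot o p q * sqdist o r - dot o q r * dot o p r)
  + dot o p r * (dot o p q * dot o q r - sqdist o q * dot o p r) = 0.
Proof. by rewrite /dot /sqdist; ring. Qed.

Lemma sqdist_gt0 p q : p != q -> 0 < sqdist p q.
Proof.
rewrite -sqdist_eq0 lt_neqAle eq_sym => -> /=.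
by rewrite addr_ge0 ?sqr_ge0 // mulr_ge0 ?sqr_ge0.
Qed.

(** With side squared [s], the dot product is [s / 2], and the Gram determinant gives
    [(4 * cross) ^ 2 = 6 * s ^ 2]. *)
Lemma no_equilateral o p q : o != p ->
  sqdist o p = sqdist o q -> sqdist o p = sqdist p q -> False.
Proof.
move=> /sqdist_gt0 s0 Eoq Epq; have d := dot_sqdist o p q; have c := cross_sqr o p q.
move: d c s0; rewrite -Eoq -Epq; move: (dot _ _ _) (cross _ _ _) (sqdist _ _).
move=> x y s d c s0.
have E : (4 * y) ^+ 2 = 6%:R * s ^+ 2 by nra.
by move: s0; rewrite (@sqr_eq_mul_prime_odd 2 6 _ s _ _ E).
Qed.

Lemma no_square o p q r : o != p -> o != q ->
  sqdist o p = sqdist p q -> sqdist o p = sqdist q r -> sqdist o p = sqdist o r ->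
  sqdist o q = sqdist p r -> False.
Proof.
move=> /sqdist_gt0 s0 /sqdist_gt0 t0 Epq Eqr Eor Epr; have := gram0 o p q r.
have := dot_sqdist o p q; have := dot_sqdist o p r; have := dot_sqdist o q r.
have := cross_sqr o p r; move: s0 t0; rewrite -Epq -Eqr -Eor -Epr.
move: (sqdist o p) (sqdist o q) (dot o p q) (dot o p r) (dot o q r) (cross _ _ _).
move=> s t x y z c s0 t0 C Z Y X G.
have yE : y = s - x by lia. have zE : z = x by lia. have tE : t = 2 * x by lia.
rewrite {}yE {}zE {}tE in G C t0 *.
(* The Gram identity becomes this product. The first root would give [t = 0]; the second makes the
   angle at [o] right, so [2 * c ^ 2 = s ^ 2]. *)
have /eqP : x ^+ 2 * (s - x) = 0 by lra.
rewrite mulf_eq0 expf_eq0 /= subr_eq0 => /orP[/eqP x0|/eqP sx].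
  by rewrite x0 in t0.
have E : (2 * c) ^+ 2 = 2%:R * s ^+ 2 by rewrite -sx in C *; lra.
by move: s0; rewrite (@sqr_eq_mul_prime_odd 2 2 _ s _ _ E).
Qed.

(* Four vertices of a regular pentagon: the ratio of the squared distances
   would be the square of the golden ratio. *)
Lemma no_pentagon o p q r : o != p -> o != q ->
  sqdist o p = sqdist p q -> sqdist o p = sqdist q r ->
  sqdist o q = sqdist p r -> sqdist o q = sqdist o r -> False.
Proof.
move=> /sqdist_gt0 s0 /sqdist_gt0 t0 Epq Eqr Epr Eor; have := gram0 o p q r.
have := dot_sqdist o p q; have := dot_sqdist o p r; have := dot_sqdist o q r.
move: s0 t0; rewrite -Epq -Eqr -Eor -Epr.
move: (sqdist o p) (sqdist o q) (dot o p q) (dot o p r) (dot o q r).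
move=> s t x y z s0 t0 Z Y X G.
have zE : z = t - y by lia. have tE : t = 2 * x by lia. have sE : s = 2 * y by lia.
rewrite {}zE {}sE {}tE in G s0 t0 *.
(* Here [x] and [y] are half the two squared distances, so [x + y] is positive; the quadratic factor
   has discriminant 5. *)
have /eqP : (x + y) * (x ^+ 2 - 3 * (x * y) + y ^+ 2) = 0 by lra.
rewrite mulf_eq0 => /orP[/eqP|/eqP H]; first by lia.
have E : (2 * y - 3 * x) ^+ 2 = 5%:R * x ^+ 2 by lra.
by move: t0; rewrite (@sqr_eq_mul_prime_odd 5 5 _ x _ _ E).
Qed.

(** Colour the six pairs by their value. Without a monochromatic triangle, one colour forms a
    4-cycle (square) or both form paths of three edges (pentagon). *)
Lemma two_sqdists_false p1 p2 p3 p4 (s t : int) : uniq [:: p1; p2; p3; p4] ->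
  {in [:: p1; p2; p3; p4] &, forall p q, p != q -> sqdist p q = s \/ sqdist p q = t} ->
  False.
Proof.
move=> /= /and4P[]; rewrite !inE !negb_or => /and3P[n12 n13 n14] /andP[n23 n24] n34 _ H.
have m1 : p1 \in [:: p1; p2; p3; p4] by rewrite !inE eqxx.
have m2 : p2 \in [:: p1; p2; p3; p4] by rewrite !inE eqxx orbT.
have m3 : p3 \in [:: p1; p2; p3; p4] by rewrite !inE eqxx !orbT.
have m4 : p4 \in [:: p1; p2; p3; p4] by rewrite !inE eqxx !orbT.
have [n21 n31 n41] : [/\ p2 != p1, p3 != p1 & p4 != p1] by rewrite ![_ == p1]eq_sym.
have [n32 n42 n43] : [/\ p3 != p2, p4 != p2 & p4 != p3].
  by rewrite [_ == p3]eq_sym ![_ == p2]eq_sym.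
case: (H _ _ m1 m2 n12) => e12; case: (H _ _ m1 m3 n13) => e13;
case: (H _ _ m1 m4 n14) => e14; case: (H _ _ m2 m3 n23) => e23;
case: (H _ _ m2 m4 n24) => e24; case: (H _ _ m3 m4 n34) => e34;
have E := (e12, e13, e14, e23, e24, e34, sqdistC p2 p1, sqdistC p3 p1,
  sqdistC p4 p1, sqdistC p3 p2, sqdistC p4 p2, sqdistC p4 p3);
solve [ by apply: (@no_equilateral p1 p2 p3); rewrite ?E
 | by apply: (@no_equilateral p1 p2 p4); rewrite ?E
 | by apply: (@no_equilateral p1 p3 p4); rewrite ?E
 | by apply: (@no_equilateral p2 p3 p4); rewrite ?E
 | by apply: (@no_square p1 p2 p3 p4); rewrite ?E
 | by apply: (@no_square p1 p2 p4 p3); rewrite ?E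
 | by apply: (@no_square p1 p3 p2 p4); rewrite ?E
 | by apply: (@no_pentagon p1 p2 p3 p4); rewrite ?E
 | by apply: (@no_pentagon p1 p2 p4 p3); rewrite ?E
 | by apply: (@no_pentagon p1 p3 p2 p4); rewrite ?E
 | by apply: (@no_pentagon p1 p3 p4 p2); rewrite ?E
 | by apply: (@no_pentagon p1 p4 p2 p3); rewrite ?E
 | by apply: (@no_pentagon p1 p4 p3 p2); rewrite ?E
 | by apply: (@no_pentagon p2 p1 p3 p4); rewrite ?E
 | by apply: (@no_pentagon p2 p1 p4 p3); rewrite ?E
 | by apply: (@no_pentagon p2 p3 p1 p4); rewrite ?E
 | by apply: (@no_pentagon p2 p4 p1 p3); rewrite ?E
 | by apply: (@no_pentagon p3 p1 p2 p4); rewrite ?E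
 | by apply: (@no_pentagon p3 p2 p1 p4); rewrite ?E ].
Qed.

(** * Values of the quadratic form *)

(** Coprimality makes [b] invertible modulo [n]; with inverse [y], [n] divides [(a * y) ^ 2 + 2]. *)
Lemma odd_dvd_form n a b : coprime a b -> odd n -> (n %| a ^ 2 + 2 * b ^ 2)%N ->
  (n %% 8 = 1 \/ n %% 8 = 3)%N.
Proof.
move=> ab on nab.
have nb : coprime n b.
  apply: coprime_dvdl nab _.
  rewrite coprime_sym addnC mulnC -mulnn -mulnA mulnC /coprime gcdnMDl.
  by rewrite -/(coprime _ _) coprime_sym coprimeXl.
have [b0|b0] := posnP b.
  by move: nb; rewrite b0 /coprime gcdn0 => /eqP ->; left.
have [y k yE _] := egcdnP n b0.
rewrite gcdnC (eqP nb) in yE.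
apply: (@odd_dvd_sq_add2 n (a * y)) => //.
have E : (y ^ 2 * (a ^ 2 + 2 * b ^ 2) = n * (2 * (k * k * n + 2 * k)) + ((a * y) ^ 2 + 2))%N.
  have -> : (y ^ 2 * (a ^ 2 + 2 * b ^ 2) = (a * y) ^ 2 + 2 * (y * b) ^ 2)%N by lia.
  by rewrite yE; lia.
by rewrite -(dvdn_addr _ (dvdn_mulr (2 * (k * k * n + 2 * k)) (dvdnn n))) -E dvdn_mull.
Qed.

(** Take [c] to be the gcd. Odd divisors of the primitive part [m] are good; if [m] is even, then
    [x] is even and [y] odd, so [m / 2] is odd. *)
Lemma form_sqr_good a b : (0 < a ^ 2 + 2 * b ^ 2)%N -> exists t c u,
  [/\ (a ^ 2 + 2 * b ^ 2 = t * (c ^ 2 * u))%N, t = 1%N \/ t = 2%N, (0 < c)%N & good u].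
Proof.
move=> ab0; set g := gcdn a b.
have g0 : (0 < g)%N by rewrite gcdn_gt0; lia.
have aE : a = (a %/ g * g)%N by rewrite divnK // dvdn_gcdl.
have bE : b = (b %/ g * g)%N by rewrite divnK // dvdn_gcdr.
move: (a %/ g)%N (b %/ g)%N aE bE => x y aE bE.
have xy : coprime x y.
  by rewrite /coprime -(eqn_pmul2r g0) muln_gcdl -aE -bE mul1n.
set m := (x ^ 2 + 2 * y ^ 2)%N.
have mE : (a ^ 2 + 2 * b ^ 2 = g ^ 2 * m)%N by rewrite aE bE /m; lia.
have m0 : (0 < m)%N by move: ab0; rewrite mE; case: (m); rewrite ?muln0.
have gd u : odd u -> (u %| m)%N -> good u.
  move=> ou um; apply/goodP; split; first exact: odd_gt0.
  by move=> d du; apply: (odd_dvd_form xy); [exact: dvdn_odd du ou | exact: dvdn_trans du um].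
have [om|em] := boolP (odd m).
  by exists 1%N, g, m; split; rewrite ?mul1n //; [left | exact: gd].
have ox : ~~ odd x by move: em; rewrite /m oddD oddM addbF oddX.
have oy : odd y.
  apply: contraT => ey; have : (2 %| gcdn x y)%N by rewrite dvdn_gcd !dvdn2 ox ey.
  by rewrite (eqP xy).
have m2 : (m = 2 * m./2)%N by rewrite mul2n even_halfK.
exists 2%N, g, m./2; split => //; [by rewrite mE {1}m2 mulnCA | by right |].
apply: gd; last by rewrite {2}m2 dvdn_mull.
have -> : (m./2 = 2 * x./2 ^ 2 + y ^ 2)%N.
  by have := even_halfK ox; rewrite /m; lia.
by rewrite oddD oddM !oddX oy orbT.
Qed.

Definition sqr_good_list N : seq nat :=
  [seq (c ^ 2 * u)%N | c <- index_iota 1 N.+1,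
                       u <- [seq u <- index_iota 1 (N %/ c ^ 2).+1 | good u]].

Lemma size_sqr_good_list (R : realType) N :
  (size (sqr_good_list N))%:R = count_sqr_good N :> R.
Proof.
rewrite /sqr_good_list size_allpairs_dep sumnE big_map natr_sum.
by apply: eq_bigr => c _; rewrite size_filter -sum1_count natr_sum.
Qed.

Lemma mem_sqr_good_list N c u : (0 < c)%N -> good u -> (c ^ 2 * u <= N)%N ->
  (c ^ 2 * u)%N \in sqr_good_list N.
Proof.
move=> c0 gu cuN; have u0 := good_gt0 gu.
apply/allpairsPdep; exists c, u; split => //.
  rewrite mem_index_iota c0 ltnS; apply: leq_trans cuN.
  by rewrite -mulnn -mulnA leq_pmulr // muln_gt0 c0.
rewrite mem_filter gu mem_index_iota u0 ltnS leq_divRL ?expn_gt0 ?c0 //.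
by rewrite mulnC.
Qed.

(** * The lattice in the Euclidean plane *)

Section Points.
Context {R : realType}.
Implicit Types p q : int * int.

Definition lattice_point p : 'rV[R]_2 :=
  \row_j (if j == 0 then p.1%:~R else Num.sqrt 2 * p.2%:~R).

Lemma dist_lattice_point p q :
  euclidean_norm (lattice_point p - lattice_point q) = Num.sqrt (sqdist p q)%:~R.
Proof.
rewrite /euclidean_norm !big_ord_recl big_ord0 addr0 !mxE /= -mulrBr exprMn.
by rewrite sqr_sqrtr // /sqdist rmorphD rmorphXn rmorphM rmorphXn /= !rmorphB.
Qed.

Lemma sqr_dist_lattice_point p q :
  euclidean_norm (lattice_point p - lattice_point q) ^+ 2 = (sqdist p q)%:~R.
Proof.
rewrite dist_lattice_point sqr_sqrtr // ler0z.
by have [->|/sqdist_gt0/ltW //] := eqVneq p q; rewrite /sqdist !subrr.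
Qed.

Lemma lattice_point_inj : injective lattice_point.
Proof.
move=> p q pq; apply/eqP; rewrite -sqdist_eq0 -(intr_eq0 R) -sqr_dist_lattice_point.
by rewrite pq sqr_dist_lattice_point /sqdist !subrr.
Qed.

Lemma three_distances (Q : {fset 'rV[R]_2}) :
  {in Q, forall v, exists p, v = lattice_point p} -> #|` Q| = 4%N ->
  (3 <= #|` distances Q|)%N.
Proof.
move=> QL Q4; rewrite leqNgt; apply/negP => D2.
have memQ v : v \in Q = (v \in enum_fset Q) by [].
have UQ := fset_uniq Q.
move: Q4 UQ; rewrite /=.
case QE : (enum_fset Q) => [|v1 [|v2 [|v3 [|v4 [|? ?]]]]] // _ UQ.
have L v : v \in [:: v1; v2; v3; v4] -> exists p, v = lattice_point p.
  by move=> vQ; apply: QL; rewrite memQ QE.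
have [p1 E1] : exists p, v1 = lattice_point p by apply: L; rewrite !inE eqxx.
have [p2 E2] : exists p, v2 = lattice_point p by apply: L; rewrite !inE eqxx ?orbT.
have [p3 E3] : exists p, v3 = lattice_point p by apply: L; rewrite !inE eqxx ?orbT.
have [p4 E4] : exists p, v4 = lattice_point p by apply: L; rewrite !inE eqxx ?orbT.
have vE : [:: v1; v2; v3; v4] = map lattice_point [:: p1; p2; p3; p4] by rewrite E1 E2 E3 E4.
rewrite vE (map_inj_uniq lattice_point_inj) in UQ QE.
pose D := enum_fset (distances Q).
(* Squared lattice distances are integers, so the floors are exact on actual distances. A missing
   entry of [D] defaults to 0, harmlessly, as each distance sits at an index within [D]. *)
apply: (@two_sqdists_false p1 p2 p3 p4 (Num.floor (D`_0 ^+ 2)) (Num.floor (D`_1 ^+ 2)) UQ).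
move=> p q pp qq pq.
have : euclidean_norm (lattice_point p - lattice_point q) \in D.
  apply/imfset2P; exists (lattice_point p); first by rewrite /= memQ QE map_f.
  exists (lattice_point q) => //; rewrite inE /= memQ QE map_f //=.
  by rewrite (inj_eq lattice_point_inj).
case/(nthP 0) => i iD Di.
have i2 : (i < 2)%N by rewrite -ltnS; apply: leq_ltn_trans D2.
have : Num.floor (D`_i ^+ 2) = sqdist p q.
  by rewrite Di sqr_dist_lattice_point intrKfloor.
by case: i i2 {iD Di} => [|[|//]] _ <-; [left|right].
Qed.
End Points.

(** * The square array and the count of its distances *)

Theorem theorem1p1 (R : realType) :
  exists C : R, 0 < C /\
    forall n : nat, (2 <= n)%N ->
      exists P : {fset 'rV[R]_2},
        [/\ #|` P| = n,
            forall Q : {fset 'rV[R]_2},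
              Q `<=` P -> #|` Q| = 4%N -> (3 <= #|` distances Q|)%N
          & #|` distances P|%:R <= C * (n%:R / Num.sqrt (ln n%:R))].
Proof.
(* [1008 = 2 * 42 * 12]: two values of [t], the constant of [count_sqr_good_le], and
   [N = 12 * n]. *)
exists 1008; split => // n n2.
have [m nm mn] : exists2 m, (n <= m ^ 2)%N & (m ^ 2 <= 4 * n)%N.
  have exm : exists m, (n <= m ^ 2)%N by exists n; rewrite -mulnn leq_pmulr // ltnW.
  case: (ex_minnP exm) => m nm mmin; exists m => //.
  case: m nm mmin => [|[|m]] nm mmin; [lia|lia|].
  (* Minimality bounds the previous square, and [m.+2 <= 2 * m.+1]. *)
  have : (m.+1 ^ 2 < n)%N by rewrite ltnNge; apply/negP => /mmin; rewrite ltnn.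
  nia.
have m0 : (0 < m)%N by case: m nm {mn} => //; lia.
pose p i : int * int := ((i %/ m)%:Z, (i %% m)%:Z).
have p_inj : injective p.
  by move=> i j [] d r; rewrite (divn_eq i m) (divn_eq j m) d r.
pose f i := lattice_point (R := R) (p i).
have f_inj : injective f := inj_comp lattice_point_inj p_inj.
pose P := [fset f i | i in iota 0 n].
exists P; split.
- by rewrite card_imfset //= undup_id ?iota_uniq // size_iota.
- move=> Q /fsubsetP QP; apply: three_distances => v /QP /imfsetP[i _ ->].
  by exists (p i).
(* Coordinate differences are at most [m], so squared distances are at most
   [3 * m ^ 2 <= 12 * n]. *)
set N := (12 * n)%N; pose s := sqr_good_list N.
have sub : distances P `<=` [fset Num.sqrt k%:R | k in s ++ map (muln 2) s].
  apply/fsubsetP => x /imfset2P[_ /imfsetP[i /= iP ->]].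
  move=> [_ /andP[/imfsetP[j /= jP ->] fij] ->] {x}.
  have pij : p i != p j by apply: contraNneq fij; rewrite /f => ->.
  rewrite dist_lattice_point.
  set a := `|i %/ m - j %/ m|%N; set b := `|i %% m - j %% m|%N.
  have dE : sqdist (p i) (p j) = (a ^ 2 + 2 * b ^ 2)%N.
    have absz_sqr (z : int) : (`|z| ^ 2)%N = z ^+ 2 :> int.
      by rewrite -mulnn PoszM abszE -expr2 real_normK ?num_real.
    by rewrite PoszD PoszM !absz_sqr.
  have ab0 : (0 < a ^ 2 + 2 * b ^ 2)%N.
    by have := sqdist_gt0 pij; rewrite dE.
  have abN : (a ^ 2 + 2 * b ^ 2 <= N)%N.
    have im : (i < m * m)%N by move: iP; rewrite mem_iota mulnn; lia.
    have jm : (j < m * m)%N by move: jP; rewrite mem_iota mulnn; lia.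
    have := ltn_pmod i m0; have := ltn_pmod j m0.
    rewrite -ltn_divLR // in im; rewrite -ltn_divLR // in jm.
    move=> jm' im'.
    have dist_le x y : (x < m)%N -> (y < m)%N -> (`|x%:Z - y%:Z| <= m)%N.
      by clear; lia.
    have am := dist_le _ _ im jm : (a <= m)%N.
    have bm := dist_le _ _ im' jm' : (b <= m)%N.
    have := leq_mul am am; have := leq_mul bm bm.
    by rewrite /N -!mulnn in mn *; lia.
  have [t [c [u [kE t12 c0 gu]]]] := form_sqr_good ab0.
  have cs : (c ^ 2 * u)%N \in s.
    apply: mem_sqr_good_list => //; apply: leq_trans abN; rewrite kE.
    by case: t12 => ->; rewrite ?mul1n // leq_pmull.
  rewrite dE kE; apply/imfsetP; exists (t * (c ^ 2 * u))%N => //=.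
  by case: t12 => ->; rewrite mem_cat ?mul1n ?cs // map_f ?orbT.
have cardD : (#|` distances P| <= 2 * size s)%N.
  apply: leq_trans (fsubset_leq_card sub) _.
  apply: leq_trans (leq_imfset_card _ _ _) _.
  by apply: leq_trans (size_undup _) _; rewrite size_cat size_map addnn mul2n.
have lnn : 0 < ln n%:R :> R by rewrite ln_gt0 // ltr1n.
have lnN : ln n%:R <= ln N%:R :> R.
  by rewrite ler_ln ?posrE ?ltr0n ?ler_nat /N; lia.
have N1 : (1 < N)%N by rewrite /N; lia.
apply: (@le_trans _ _ (2 * (42 * N%:R / Num.sqrt (ln N%:R)))).
  apply: le_trans (_ : (2 * size s)%:R <= _); first by rewrite ler_nat.
  by rewrite natrM ler_pM2l // size_sqr_good_list count_sqr_good_le.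
have -> : 2 * (42 * N%:R / Num.sqrt (ln N%:R)) = 1008 * (n%:R / Num.sqrt (ln N%:R)) :> R.
  by rewrite /N natrM; ring.
rewrite ler_pM2l // ler_wpM2l // lef_pV2 ?posrE ?sqrtr_gt0 //.
  exact: ler_wsqrtr.
by rewrite (lt_le_trans lnn).
Qed.
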